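(* Let $M$ be a countable conical refinement monoid. Then there are a dimension monoid $\Delta$ and a surjective monoid morphism $\alpha\colon\Delta\to M$ such that $x\propto y$ for every pair of elements $x,y$ in $\Delta$ that satisfy $\alpha(x)\propto\alpha(y)$.
   Context: All monoids are abelian, written additively. A monoid $M$ is conical if $x+y=0$ implies $x=y=0$. $M$ is a refinement monoid if whenever $x_1+x_2=y_1+y_2$ in $M$ there are $z_{ij}\in M$ ($i,j\in\{1,2\}$) with $x_i=z_{i1}+z_{i2}$ and $y_i=z_{1i}+z_{2i}$ for $i=1,2$. The order on $M$ is the algebraic preorder: $x\le y$ if $x+z=y$ for some $z\in M$. Write $x\propto y$ if $x\le ny$ for some natural number $n$. A simplicial monoid is a monoid of the form $(\mathbb{Z}^+)^r$, where $r$ is a natural number and $\mathbb{Z}^+=\{0,1,2,\dots\}$. A dimension monoid is a monoid that can be written as an inductive limit of a sequence of simplicial monoids and monoid morphisms. *)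

(* Defs.v *)
From HB Require Import structures.
From mathcomp Require Import all_boot all_order all_algebra.
From mathcomp Require Import classical_sets cardinality.

Set Implicit Arguments.
Unset Strict Implicit.
Unset Printing Implicit Defensive.

Import GRing.Theory.
Local Open Scope ring_scope.

(* Abelian monoids are [nmodType]s; monoid morphisms are [{additive _ -> _}],
   which on [nmodType]s preserve both 0 and +. *)

Definition conical (M : nmodType) : Prop :=
  forall x y : M, x + y = 0 -> x = 0 /\ y = 0.

Definition refinement_monoid (M : nmodType) : Prop :=
  forall x1 x2 y1 y2 : M, x1 + x2 = y1 + y2 ->
  exists z11 z12 z21 z22 : M,
    [/\ x1 = z11 + z12, x2 = z21 + z22, y1 = z11 + z21 & y2 = z12 + z22].

Definition alg_le (M : nmodType) (x y : M) : Prop := exists z : M, x + z = y.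

Definition propto (M : nmodType) (x y : M) : Prop :=
  exists n : nat, alg_le x (y *+ n).

(* Here [nat] carries its additive monoid structure and the operations on
   functions are pointwise. *)
Definition simplicial (r : nat) : nmodType := {ffun 'I_r -> nat}.

(* [D], with the limiting maps [psi], is the inductive limit (colimit) of
     S 0 --phi 0--> S 1 --phi 1--> S 2 --> ...
   in the category of abelian monoids. *)
Definition is_inductive_limit (S : nat -> nmodType)
    (phi : forall n, {additive S n -> S n.+1})
    (D : nmodType) (psi : forall n, {additive S n -> D}) : Prop :=
  (forall n, psi n.+1 \o phi n =1 psi n) /\
  (forall (N : nmodType) (f : forall n, {additive S n -> N}),
     (forall n, f n.+1 \o phi n =1 f n) ->
     exists g : {additive D -> N},
       (forall n, g \o psi n =1 f n) /\
       (forall h : {additive D -> N}, (forall n, h \o psi n =1 f n) -> h =1 g)).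

Definition dimension_monoid (D : nmodType) : Prop :=
  exists (r : nat -> nat)
         (phi : forall n, {additive simplicial (r n) -> simplicial (r n.+1)})
         (psi : forall n, {additive simplicial (r n) -> D}),
    is_inductive_limit phi psi.

(* Main.v *)
Require Import Defs.
From HB Require Import structures.
From mathcomp Require Import all_boot all_order all_algebra.
From mathcomp Require Import boolp classical_sets cardinality.

Set Implicit Arguments.
Unset Strict Implicit.
Unset Printing Implicit Defensive.

Import GRing.Theory.
Local Open Scope ring_scope.

(** The monoid Delta is built as the limit of a sequence of simplicial monoids
S_n, each carrying a morphism alpha_n to M, with transition morphisms over M.
Two things have to be arranged: every element of M must be hit at some stage,
and whenever alpha_n x propto alpha_n y, the images of x and y one stage later
must already be so related. The first is free: a
generator can be adjoined for the n-th element of M ([adjoin]).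

For the second, [x propto y] in a simplicial monoid only says that the support
of x lies in that of y. Let a_i be the images of the generators e_i, and
suppose that alpha x propto alpha y. A generator e_i in the support of x but
not in that of y has a_i <= n * alpha y, so refinement, conicality being what
handles the empty sum, gives a_i = sum_j d_ij with d_ij propto y_j a_j
([propto_decomp]). For a fixed j, all the d_ij can be expressed with a single
decomposition of a_j: there are elements g_jt of M with a_j = sum_t g_jt and
d_ij = sum_t w_ijt g_jt, where the w_ijt are natural numbers
([weighted_refinementP]). Take the g_jt as the new generators, send e_j to
sum_t e_jt for every other j, and send e_i to the sum of the w_ijt e_jt over
the j in the support of y. This is a morphism over M, and the image of x is
now supported in the image of y ([absorb_pair]).

A stage has infinitely many pairs (x, y), but propto only sees supports, so
finitely many 0/1 vectors represent all of them and one stage can treat them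
one after the other ([absorb_all]). In the limit, any two elements come from a
common stage, and morphisms preserve propto, so no pair needs to be revisited
later. *)

(** * The relation propto *)

Section Propto.
Variable N : nmodType.
Implicit Types x y z : N.

Lemma propto0 y : propto 0 y.
Proof. by exists 0%N, 0; rewrite addr0 mulr0n. Qed.

Lemma propto_addr x z : propto x (x + z).
Proof. by exists 1%N, z; rewrite mulr1n. Qed.

Lemma propto_refl x : propto x x.
Proof. by rewrite -{2}[x]addr0; exact: propto_addr. Qed.

Lemma proptoD x y z : propto x z -> propto y z -> propto (x + y) z.
Proof.
move=> [m [u xu]] [n [v yv]]; exists (m + n)%N, (u + v).
by rewrite mulrnDr -xu -yv addrACA.
Qed.

Lemma propto_sum (I : Type) (s : seq I) (P : pred I) (F : I -> N) z :
  (forall i, P i -> propto (F i) z) -> propto (\sum_(i <- s | P i) F i) z.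
Proof. by move=> Fz; elim/big_ind: _ => // [|x y]; [exact: propto0|exact: proptoD]. Qed.

Lemma proptoMn x z n : propto x z -> propto (x *+ n) z.
Proof. by move=> xz; rewrite -[n]card_ord -sumr_const; exact: propto_sum. Qed.

Lemma propto_trans y x z : propto x y -> propto y z -> propto x z.
Proof.
move=> [m [u xu]] /(proptoMn m)[n [v yv]]; exists n, (u + v).
by rewrite addrA xu.
Qed.

Lemma propto_sumr (I : finType) (F : I -> N) i : propto (F i) (\sum_j F j).
Proof. by rewrite (bigD1 i) //=; exact: propto_addr. Qed.

Lemma propto_Mnr x n : (0 < n)%N -> propto x (x *+ n).
Proof. by case: n => // n _; rewrite mulrS; exact: propto_addr. Qed.

End Propto.

Lemma propto_additive (N P : nmodType) (f : {additive N -> P}) (x y : N) :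
  propto x y -> propto (f x) (f y).
Proof. by move=> [n [z xz]]; exists n, (f z); rewrite -raddfD xz raddfMn. Qed.

(** * Simultaneous refinements in a conical refinement monoid *)

Section Refinement.
Variable M : nmodType.
Hypothesis M0 : conical M.
Hypothesis MR : refinement_monoid M.

Lemma conical_propto0 (x : M) : propto x 0 -> x = 0.
Proof. by move=> [n [z]]; rewrite mul0rn => /M0[]. Qed.

(** Conicality is what makes the empty sum decompose; everything else is
refinement applied to one summand at a time. *)
Lemma refine_sum_seq (I : eqType) (s : seq I) (b : I -> M) (x z : M) :
  uniq s -> x + z = \sum_(i <- s) b i ->
  exists u v : I -> M,
    [/\ {in s, forall i, b i = u i + v i}, x = \sum_(i <- s) u i
      & z = \sum_(i <- s) v i].
Proof.
elim: s x z => [|k s IHs] x z /=.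
  move=> _; rewrite big_nil => /M0[-> ->].
  by exists (fun _ => 0), (fun _ => 0); rewrite !big_nil.
move=> /andP[ks us]; rewrite big_cons => /MR[p [q [p' [q' [-> -> bk]]]]].
move=> /esym/(IHs _ _ us)[u [v [buv -> ->]]].
exists (fun i => if i == k then p else u i), (fun i => if i == k then p' else v i).
have noks (w : I -> M) (c : M) :
    \sum_(i <- s) (if i == k then c else w i) = \sum_(i <- s) w i.
  by apply: eq_big_seq => i si; case: eqVneq => // ik; rewrite -ik si in ks.
rewrite !big_cons eqxx !noks; split => // i; rewrite inE.
by case: eqVneq => [->|_] //= /buv.
Qed.

Lemma refine_sum (I : finType) (b : I -> M) (x z : M) :
  x + z = \sum_i b i ->
  exists u v : I -> M,
    [/\ forall i, b i = u i + v i, x = \sum_i u i & z = \sum_i v i].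
Proof.
move=> /(refine_sum_seq (index_enum_uniq I))[u [v [buv -> ->]]].
by exists u, v; split => // i; apply: buv; rewrite mem_index_enum.
Qed.

(** A Riesz decomposition for propto: the term [d i] is controlled by
[a i *+ y i], and so vanishes where [y i = 0]. *)
Lemma propto_decomp (I : finType) (a : I -> M) (y : I -> nat) (p : M) :
  propto p (\sum_i a i *+ y i) ->
  exists d : I -> M, p = \sum_i d i /\ forall i, propto (d i) (a i *+ y i).
Proof.
move=> [n [z]]; rewrite -sumrMnl => /refine_sum[u [v [auv -> _]]].
by exists u; split => // i; exists n, (v i).
Qed.

(** The weights are unrestricted natural numbers because the [p k] are only
bounded by multiples of [a]; weights 0 and 1 would only do for [p k] below [a]. *)
Definition weighted_refinement (K : Type) (a : M) (p : K -> M) :=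
  exists (T : finType) (g : T -> M) (w : K -> T -> nat),
    a = \sum_t g t /\ forall k, p k = \sum_t g t *+ w k t.

Lemma weighted_refinement0 (K : Type) (a : M) :
  weighted_refinement a (fun _ : K => 0).
Proof.
exists unit, (fun _ => a), (fun _ _ => 0%N); split=> [|_]; last by rewrite big1.
by rewrite (big_pred1 tt) // => -[].
Qed.

(** Splitting every piece of [a] along [a = q + z] makes [q] the sum of the
pieces marked [true], while old weights carry over to both halves. The
multiplicities [h] let the new element be added to a chosen member of the
family. *)
Lemma weighted_refinement_le (K : Type) (a q z : M) (p : K -> M) (h : K -> nat) :
  weighted_refinement a p -> q + z = a ->
  weighted_refinement a (fun k => p k + q *+ h k).
Proof.
move=> [T [g [w [ag pg]]]]; rewrite {1}ag => /refine_sum[u [v [guv -> _]]].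
exists (T * bool)%type, (fun t => if t.2 then u t.1 else v t.1).
exists (fun k (t : T * bool) => w k t.1 + t.2 * h k)%N.
split=> [|k].
  rewrite -(pair_bigA _ (fun t c => if c then u t else v t)) /= ag.
  by apply: eq_bigr => t _; rewrite big_bool guv.
rewrite pg -sumrMnl -big_split /=.
rewrite -(pair_bigA _ (fun t (c : bool) =>
  (if c then u t else v t) *+ (w k t + c * h k))) /=.
apply: eq_bigr => t _; rewrite big_bool /= mul1n mul0n addn0 guv.
by rewrite mulrnDr mulrnDl addrAC.
Qed.

(** An element below a multiple of [a] is a sum of elements below [a], which
can be incorporated one by one. *)
Lemma weighted_refinement_propto (K : Type) (a q : M) (p : K -> M) (h : K -> nat) :
  weighted_refinement a p -> propto q a ->
  weighted_refinement a (fun k => p k + q *+ h k).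
Proof.
move=> wp [n [z]]; elim: n q z => [|n IHn] q z.
  rewrite mulr0n => /M0[-> _].
  by have -> : (fun k => p k + 0 *+ h k) = p; [apply/funext => k; rewrite mul0rn addr0|].
rewrite mulrS => /MR[q1 [q2 [z1 [z2 [-> _ aE /esym/IHn wq]]]]].
have := weighted_refinement_le h wq (esym aE).
by congr weighted_refinement; apply/funext => k; rewrite mulrnDl addrAC addrA.
Qed.

(** The family [p] is the sum of its members, each concentrated at one index,
so it can be reached from the zero family. *)
Lemma weighted_refinementP (K : finType) (a : M) (p : K -> M) :
  (forall k, propto (p k) a) -> weighted_refinement a p.
Proof.
move=> pa.
have -> : p = fun k => \sum_(l <- index_enum K) p l *+ (k == l).
  apply/funext => k; rewrite (bigD1 k) //= eqxx big1 ?addr0 // => l.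
  by rewrite eq_sym => /negPf->.
elim: index_enum => [|l s IHs].
  have -> : (fun k => \sum_(l <- [::]) p l *+ (k == l)) = fun _ => 0.
    by apply/funext => k; rewrite big_nil.
  exact: weighted_refinement0.
have := weighted_refinement_propto (fun k => k == l) IHs (pa l).
by congr weighted_refinement; apply/funext => k; rewrite big_cons addrC.
Qed.

End Refinement.

(** * Simplicial monoids *)

Section Lin.
Variables (r : nat) (N : nmodType) (c : 'I_r -> N).

Definition lin (x : simplicial r) : N := \sum_i c i *+ x i.

Lemma lin_is_additive : nmod_morphism lin.
Proof.
split=> [|x y]; first by rewrite /lin big1 // => i _; rewrite ffunE mulr0n.
by rewrite /lin -big_split; apply: eq_bigr => i _; rewrite ffunE mulrnDr.
Qed.

HB.instance Definition _ :=
  GRing.isNmodMorphism.Build (simplicial r) N lin lin_is_additive.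

End Lin.

Section Simplicial.
Variable r : nat.

Definition unitv (i : 'I_r) : simplicial r := [ffun j => (i == j) : nat].

Lemma lin_unitv (N : nmodType) (c : 'I_r -> N) i : lin c (unitv i) = c i.
Proof.
rewrite /lin (bigD1 i) //= ffunE eqxx mulr1n big1 ?addr0 // => j.
by rewrite ffunE eq_sym => /negPf->; rewrite mulr0n.
Qed.

Lemma simplicialE (x : simplicial r) : x = \sum_i unitv i *+ x i.
Proof.
apply/ffunP => j; rewrite sum_ffunE (bigD1 j) //= ffunMnE ffunE eqxx natn.
by rewrite big1 ?addr0 // => i /negPf ij; rewrite ffunMnE ffunE ij mul0rn.
Qed.

Lemma additiveE (N : nmodType) (f : {additive simplicial r -> N}) x :
  f x = \sum_i f (unitv i) *+ x i.
Proof.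
by rewrite {1}[x]simplicialE raddf_sum; apply: eq_bigr => i _; rewrite raddfMn.
Qed.

Lemma additive_eq (N : nmodType) (f g : {additive simplicial r -> N}) :
  (forall i, f (unitv i) = g (unitv i)) -> f =1 g.
Proof.
by move=> fg x; rewrite !additiveE; apply: eq_bigr => i _; rewrite fg.
Qed.

Lemma propto_unitv (x : simplicial r) i : (0 < x i)%N -> propto (unitv i) x.
Proof.
move=> xi; apply: (@propto_trans _ (unitv i *+ x i)); first exact: propto_Mnr.
by rewrite {2}[x]simplicialE; exact: (propto_sumr (fun i => unitv i *+ x i)).
Qed.

Lemma propto_support (x y : simplicial r) :
  (forall i, y i = 0%N -> x i = 0%N) -> propto x y.
Proof.
move=> xy; rewrite [x]simplicialE; apply: propto_sum => i _.
case: (posnP (y i)) => [/xy-> | /propto_unitv]; first exact: propto0.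
exact: proptoMn.
Qed.

Definition indicator (f : {ffun 'I_r -> bool}) : simplicial r := [ffun i => f i : nat].

(** This is what reduces the pairs of elements of a simplicial monoid to
finitely many, as far as propto is concerned. *)
Lemma propto_indicator (x : simplicial r) :
  exists f, propto x (indicator f) /\ propto (indicator f) x.
Proof.
exists [ffun i => x i != 0%N].
by split; apply: propto_support => i; rewrite !ffunE; [case: eqP | move->].
Qed.

End Simplicial.

(** * Enlarging a simplicial monoid over M *)

Section Extension.
Variable M : nmodType.
Hypothesis M0 : conical M.
Hypothesis MR : refinement_monoid M.

(** The new generators are the pairs [(j, t)], where [t] indexes a common
refinement of [alpha e_j] for all the parts of it that are used to write the
other generators. *)
Lemma absorb_pair r (alpha : {additive simplicial r -> M}) (x y : simplicial r) :
  propto (alpha x) (alpha y) ->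
  exists s (beta : {additive simplicial s -> M})
         (phi : {additive simplicial r -> simplicial s}),
    beta \o phi =1 alpha /\ propto (phi x) (phi y).
Proof.
move=> xy; pose a i := alpha (unitv i).
(* Only the generators selected by Z obstruct the support condition. *)
pose Z i := (0 < x i)%N && (y i == 0%N).
have /fin_all_exists[d dP] (i : 'I_r) : exists d : 'I_r -> M,
    (Z i -> a i = \sum_j d j) /\ forall j, propto (d j) (a j *+ y j).
  case Zi: (Z i); last by exists (fun _ => 0); split => // j; exact: propto0.
  have : propto (a i) (\sum_j a j *+ y j).
    rewrite -additiveE; apply: propto_trans xy; apply/propto_additive/propto_unitv.
    by case/andP: Zi.
  by move=> /(propto_decomp M0 MR)[e [aE eP]]; exists e.
have /fin_all_exists[T /fin_all_exists[g /fin_all_exists[w wP]]] (j : 'I_r) :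
    weighted_refinement (a j) (d^~ j).
  apply: (weighted_refinementP M0 MR) => i.
  by apply: (propto_trans (proj2 (dP i) j)); exact/proptoMn/propto_refl.
pose U : finType := {j : 'I_r & T j}.
(* Cutting the weights off where y vanishes costs nothing, since d i j = 0
   there, and it forces the support of phi e_i into that of phi y. *)
pose C i (p : U) : nat :=
  if Z i then (if (0 < y (tag p))%N then w (tag p) i (tagged p) else 0)%N
  else i == tag p.
pose G (p : U) := g (tag p) (tagged p).
pose c i : simplicial #|U| := [ffun k => C i (enum_val k)].
exists #|U|, (lin (fun k => G (enum_val k))), (lin c); split.
  apply: additive_eq => i /=; rewrite lin_unitv -/(a i).
  transitivity (\sum_p G p *+ C i p).
    rewrite (big_enum_val (A := U) (fun p => G p *+ C i p)) /=.
    by apply: eq_bigr => k _; rewrite ffunE.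
  transitivity (\sum_j \sum_t g j t *+ C i (Tagged T t)).
    by rewrite sig_big_dep; apply: eq_big => [//|[j t] _].
  rewrite /C /=; case Zi: (Z i).
    rewrite (proj1 (dP i)) //; apply: eq_bigr => j _.
    case: posnP => yj; last by rewrite (proj2 (wP j)).
    rewrite (conical_propto0 M0 (x := d i j)) ?big1 //.
    by have := proj2 (dP i) j; rewrite yj mulr0n.
  rewrite (bigD1 i) //= eqxx -(proj1 (wP i)) big1 ?addr0 // => j.
  by rewrite eq_sym => /negPf->; rewrite big1.
apply: propto_support => k.
rewrite /= /lin !sum_ffunE; set p := enum_val k; pose j := tag p.
have cE i (n : nat) : (c i *+ n) k = (C i p * n)%N.
  by rewrite ffunMnE ffunE -mulr_natr natn.
(* A generator outside the support of phi y lies over some j with y j = 0: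
   otherwise j is not in Z, and e_j contributes e_(j,t) to phi y. *)
move=> y0; have yj : y j = 0%N.
  move: y0; rewrite (bigD1 j) //= cE /C {1}/Z.
  case: (posnP (y j)) => // yj; rewrite andbF eqxx mul1n.
  by case: (y j) yj.
rewrite big1 // => i _; rewrite cE /C -/j yj /=.
case: (posnP (x i)) => [-> | xi]; first by rewrite muln0.
rewrite /Z xi /=; case: eqP => // yi.
by case: eqP yi => [-> |].
Qed.

(** Each extension preserves the relations propto obtained so far, so the pairs
can be treated in turn; the remaining ones are pushed forward, which is why the
induction is on the size of the list rather than on the list. *)
Lemma absorb_seq r (alpha : {additive simplicial r -> M})
    (ps : seq (simplicial r * simplicial r)) :
  exists s (beta : {additive simplicial s -> M})
         (phi : {additive simplicial r -> simplicial s}),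
    beta \o phi =1 alpha /\
    {in ps, forall p, propto (alpha p.1) (alpha p.2) -> propto (phi p.1) (phi p.2)}.
Proof.
have [n] := ubnP (size ps); elim: n r alpha ps => // n IHn r alpha [_|[x y] ps] /=.
  by exists r, alpha, idfun.
rewrite ltnS => psn.
have [s [beta [phi [bp xy]]]] : exists s (beta : {additive simplicial s -> M})
    (phi : {additive simplicial r -> simplicial s}), beta \o phi =1 alpha /\
    (propto (alpha x) (alpha y) -> propto (phi x) (phi y)).
  have [/absorb_pair[s [beta [phi [bp xy]]]]|nxy] := pselect (propto (alpha x) (alpha y)).
    by exists s, beta, phi.
  by exists r, alpha, idfun; split.
have [|t [gamma [chi [gc IH]]]] := IHn _ beta [seq (phi p.1, phi p.2) | p <- ps].
  by rewrite size_map.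
exists t, gamma, (chi \o phi); split=> [z|p]; first by rewrite -bp; exact: gc.
rewrite inE => /predU1P[-> /xy|pps pxy]; first exact: propto_additive.
apply: (IH (phi p.1, phi p.2)).
  exact: (map_f (fun q => (phi q.1, phi q.2))).
by move: pxy; rewrite -!bp.
Qed.

Lemma absorb_all r (alpha : {additive simplicial r -> M}) :
  exists s (beta : {additive simplicial s -> M})
         (phi : {additive simplicial r -> simplicial s}),
    beta \o phi =1 alpha /\
    forall x y, propto (alpha x) (alpha y) -> propto (phi x) (phi y).
Proof.
have [s [beta [phi [bp ps]]]] := absorb_seq alpha
  [seq (indicator f, indicator g) |
     f <- enum {ffun 'I_r -> bool}, g <- enum {ffun 'I_r -> bool}].
exists s, beta, phi; split => // x y xy.
have [[f [xf fx]] [g [yg gy]]] := (propto_indicator x, propto_indicator y).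
apply: (propto_trans (propto_additive phi xf)).
apply: (propto_trans _ (propto_additive phi gy)).
apply: (ps (indicator f, indicator g)) => /=.
  by apply/allpairsP; exists (f, g); rewrite !mem_enum.
apply: (propto_trans (propto_additive alpha fx)).
exact: (propto_trans xy (propto_additive alpha yg)).
Qed.

Lemma adjoin r (alpha : {additive simplicial r -> M}) (m : M) :
  exists s (beta : {additive simplicial s -> M})
         (phi : {additive simplicial r -> simplicial s}),
    beta \o phi =1 alpha /\ exists x, beta x = m.
Proof.
exists r.+1, (lin (fun k => oapp (alpha \o @unitv r) m (unlift ord0 k))).
exists (lin (fun i => unitv (lift ord0 i))); split; last first.
  by exists (unitv ord0); rewrite /= lin_unitv unlift_none.
by apply: additive_eq => i; rewrite /= !lin_unitv liftK.
Qed.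

Lemma extension_step r (alpha : {additive simplicial r -> M}) (m : M) :
  exists s (beta : {additive simplicial s -> M})
         (phi : {additive simplicial r -> simplicial s}),
    [/\ beta \o phi =1 alpha, exists x, beta x = m
      & forall x y, propto (alpha x) (alpha y) -> propto (phi x) (phi y)].
Proof.
have [s [beta [phi [bp ab]]]] := absorb_all alpha.
have [t [gamma [chi [gc gm]]]] := adjoin beta m.
exists t, gamma, (chi \o phi); split => // [x|x y /ab]; last exact: propto_additive.
by rewrite -bp; exact: gc.
Qed.

End Extension.

(** * Limits of sequences of abelian monoids *)

Section Colimit.
Variables (S : nat -> nmodType) (phi : forall n, {additive S n -> S n.+1}).

(** [S n] and [S m] are different types even when [n = m] is provable; this
family, equal to [x] at [n] and 0 elsewhere, confines the transport to one
place. *)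
Definition point n (x : S n) m : S m := tagged_as (Tagged S (0 : S m)) (Tagged S x).

Lemma point_id n (x : S n) : point x n = x.
Proof. by rewrite /point tagged_asE. Qed.

Lemma point_neq n (x : S n) m : n != m -> point x m = 0.
Proof.
move=> /eqP nm; rewrite /point /tagged_as /=.
by case: eqP => // e; case: nm; exact: esym.
Qed.

(** The images of [x] at all later stages, extended by 0 to the earlier ones.
Defining it by adding [point x m] at each [m] needs no comparison between [n]
and [m], and makes it additive in [x]. *)
Fixpoint thread n (x : S n) m : S m :=
  point x m + match m with 0 => 0 | m'.+1 => phi m' (thread x m') end.

Lemma thread_lt n (x : S n) m : (m < n)%N -> thread x m = 0.
Proof.
elim: m => [|m IHm] mn /=; rewrite point_neq ?add0r ?gtn_eqF //.
by rewrite IHm ?raddf0 // ltnW.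
Qed.

Lemma thread_id n (x : S n) : thread x n = x.
Proof.
case: n x => [|n] x /=; rewrite point_id ?addr0 //.
by rewrite thread_lt // raddf0 addr0.
Qed.

Lemma threadS n (x : S n) m : (n <= m)%N -> thread x m.+1 = phi m (thread x m).
Proof. by move=> nm /=; rewrite point_neq ?add0r // ltn_eqF. Qed.

Lemma threadD n (x y : S n) m : thread (x + y) m = thread x m + thread y m.
Proof.
have pD k : point (x + y) k = point x k + point y k.
  case: (eqVneq n k) => [<-|nk]; first by rewrite !point_id.
  by rewrite !point_neq // addr0.
elim: m => [|m IHm] /=; rewrite pD; first by rewrite !addr0.
by rewrite IHm raddfD addrACA.
Qed.

Lemma thread0 n m : thread (0 : S n) m = 0.
Proof.
have p0 k : point (0 : S n) k = 0.
  by case: (eqVneq n k) => [<-|nk]; [rewrite point_id | rewrite point_neq].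
by elim: m => [|m IHm] /=; rewrite p0 add0r // IHm raddf0.
Qed.

Lemma thread_trans n (x : S n) m k :
  (n <= m)%N -> (m <= k)%N -> thread (thread x m) k = thread x k.
Proof.
move=> nm /subnK <-; elim: (k - m)%N => [|l IHl]; first by rewrite add0n thread_id.
by rewrite addSn !threadS ?IHl ?leq_addl // (leq_trans nm) ?leq_addl.
Qed.

Definition germ : choiceType := {n : nat & S n}.
Definition gthread (u : germ) m := thread (tagged u) m.

Definition eqgerm (u v : germ) : bool :=
  `[< exists k, forall m, (k <= m)%N -> gthread u m = gthread v m >].

Lemma eqgerm_refl : reflexive eqgerm.
Proof. by move=> u; apply/asboolP; exists 0%N. Qed.

Lemma eqgerm_sym : symmetric eqgerm.
Proof.
by move=> u v; apply/idP/idP => /asboolP[k uv]; apply/asboolP; exists k => m /uv.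
Qed.

Lemma eqgerm_trans : transitive eqgerm.
Proof.
move=> v u w /asboolP[k uv] /asboolP[l vw]; apply/asboolP; exists (maxn k l) => m.
by rewrite geq_max => /andP[km lm]; rewrite uv ?vw.
Qed.

Canonical eqgerm_equiv := EquivRel eqgerm eqgerm_refl eqgerm_sym eqgerm_trans.

(** Elements that agree from some stage on are identified, which is the usual
description of a sequential colimit. *)
Definition colim := {eq_quot eqgerm}%qT.
HB.instance Definition _ := Choice.on colim.

Definition to_colim (u : germ) : colim := \pi_colim%qT u.

Lemma to_colimP u v : to_colim u = to_colim v <->
  exists k, forall m, (k <= m)%N -> gthread u m = gthread v m.
Proof.
split=> [/eqmodP/asboolP //|uv]; by apply/eqmodP/asboolP.
Qed.

Lemma to_colim_surj (d : colim) : exists u, d = to_colim u.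
Proof. by exists (repr d); rewrite /to_colim reprK. Qed.

Definition gadd (u v : germ) : germ :=
  let k := maxn (tag u) (tag v) in Tagged S (gthread u k + gthread v k).

Lemma gthread_add u v m : (maxn (tag u) (tag v) <= m)%N ->
  gthread (gadd u v) m = gthread u m + gthread v m.
Proof.
by move=> uvm; rewrite /gthread /= threadD !thread_trans // ?leq_maxl ?leq_maxr.
Qed.

Definition cadd (d e : colim) : colim := to_colim (gadd (repr d) (repr e)).
Definition czero : colim := to_colim (Tagged S (0 : S 0%N)).

Lemma cadd_to_colim u v : cadd (to_colim u) (to_colim v) = to_colim (gadd u v).
Proof.
have reprP w : exists k, forall m, (k <= m)%N ->
    gthread (repr (to_colim w)) m = gthread w m.
  by apply/to_colimP; rewrite {1}/to_colim reprK.
have [[k ku] [l lv]] := (reprP u, reprP v).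
set ru := repr _ in ku *; set rv := repr _ in lv *.
apply/to_colimP.
exists (maxn (maxn k l) (maxn (maxn (tag ru) (tag rv)) (maxn (tag u) (tag v)))) => m.
rewrite !geq_max => /and3P[/andP[km lm] /andP[rum rvm] /andP[um vm]].
by rewrite !gthread_add ?geq_max ?rum ?rvm ?um ?vm // ku ?lv.
Qed.

Lemma caddC : commutative cadd.
Proof.
move=> d e; have [[u ->] [v ->]] := (to_colim_surj d, to_colim_surj e).
rewrite !cadd_to_colim; apply/to_colimP; exists (maxn (tag u) (tag v)) => m uvm.
have vum : (maxn (tag v) (tag u) <= m)%N by rewrite maxnC.
by rewrite !gthread_add // addrC.
Qed.

Lemma caddA : associative cadd.
Proof.
move=> d e f; have [u ->] := to_colim_surj d; have [v ->] := to_colim_surj e.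
have [w ->] := to_colim_surj f.
rewrite !cadd_to_colim; apply/to_colimP.
exists (maxn (tag u) (maxn (tag v) (tag w))) => m; rewrite !geq_max => /and3P[um vm wm].
by rewrite !gthread_add /= ?geq_max ?um ?vm ?wm //= addrA.
Qed.

Lemma cadd0 : left_id czero cadd.
Proof.
move=> d; have [u ->] := to_colim_surj d.
rewrite cadd_to_colim; apply/to_colimP; exists (tag u) => m um.
by rewrite gthread_add ?max0n // {1}/gthread thread0 add0r.
Qed.

HB.instance Definition _ := GRing.isNmodule.Build colim caddA caddC cadd0.

Definition colim_in n (x : S n) : colim := to_colim (Tagged S x).

Lemma colim_in_is_additive n : nmod_morphism (@colim_in n).
Proof.
split=> [|x y].
  by apply/to_colimP; exists 0%N => m _; rewrite /gthread !thread0.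
rewrite [RHS]cadd_to_colim; apply/to_colimP; exists n => m nm.
by rewrite gthread_add ?maxnn // /gthread threadD.
Qed.

HB.instance Definition _ n :=
  GRing.isNmodMorphism.Build (S n) colim (@colim_in n) (@colim_in_is_additive n).

Lemma colim_in_thread n (x : S n) m : (n <= m)%N -> colim_in (thread x m) = colim_in x.
Proof.
move=> nm; apply/to_colimP; exists m => k mk.
by rewrite /gthread /= thread_trans.
Qed.

Lemma colim_inS n : @colim_in n.+1 \o phi n =1 @colim_in n.
Proof.
move=> x /=; rewrite -[RHS](colim_in_thread x (leqnSn n)).
by rewrite threadS // thread_id.
Qed.

Lemma colim_in_surj2 (d e : colim) :
  exists n (x y : S n), d = colim_in x /\ e = colim_in y.
Proof.
have [[n x] ->] := to_colim_surj d; have [[m y] ->] := to_colim_surj e.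
exists (maxn n m), (thread x (maxn n m)), (thread y (maxn n m)).
by rewrite !colim_in_thread ?leq_maxl ?leq_maxr.
Qed.

(** A compatible family is constant along threads, so its value at any
representative of a germ defines the mediating morphism. *)
Lemma colim_is_limit : is_inductive_limit phi (fun n => @colim_in n).
Proof.
split=> [n|N f fphi]; first exact: colim_inS.
have f_thread n (x : S n) m : (n <= m)%N -> f m (thread x m) = f n x.
  move=> /subnK <-; elim: (m - n)%N => [|k IHk]; first by rewrite add0n thread_id.
  by rewrite addSn threadS ?leq_addl // -IHk; exact: fphi.
pose g (d : colim) := f _ (tagged (repr d)).
have g_in n (x : S n) : g (colim_in x) = f n x.
  rewrite /g; have : to_colim (repr (colim_in x)) = to_colim (Tagged S x).
    by rewrite {1}/to_colim reprK.
  move=> /to_colimP[k]; set u := repr _ => kP.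
  pose m := maxn k (maxn (tag u) n).
  have [km um nm] : [/\ (k <= m)%N, (tag u <= m)%N & (n <= m)%N].
    by rewrite /m; split; rewrite !leq_max leqnn ?orbT.
  rewrite -(f_thread _ _ _ um) -(f_thread _ _ _ nm); congr (f m _); exact: kP.
have gM : nmod_morphism g.
  split=> [|d e]; first by rewrite -[0]/(colim_in (0 : S 0%N)) g_in raddf0.
  have [n [x [y [-> ->]]]] := colim_in_surj2 d e.
  by rewrite -raddfD !g_in raddfD.
pose gmix := GRing.isNmodMorphism.Build _ _ g gM.
pose G : {additive colim -> N} := HB.pack g gmix.
exists G; split=> [n x|h hP d]; first exact: g_in.
have [n [x [_ [-> _]]]] := colim_in_surj2 d d.
by rewrite [RHS]g_in -hP.
Qed.

End Colimit.

(** * The sequence of stages *)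

(** Repetitions are allowed, so the value 0 can be used at indices that the
injection of [M] into [nat] misses. *)
Lemma countable_enum (M : nmodType) :
  countable [set: M]%classic -> exists e : nat -> M, forall m, exists n, e n = m.
Proof.
move=> /countable_injP[f fI].
have /choice[e eP] (n : nat) : exists m, forall m', f m' = n -> m = m'.
  have [[m fm]|nm] := pselect (exists m, f m = n); last first.
    by exists 0 => m' fm'; case: nm; exists m'.
  by exists m => m' fm'; apply: fI; rewrite ?in_setT // fm.
by exists e => m; exists (f m); exact: eP.
Qed.

Definition stage (M : nmodType) := {r : nat & {additive simplicial r -> M}}.

(** The extension at one stage already settles all instances of propto among the
elements of that stage, so the recursion needs no memory of earlier stages. *)
Lemma stage_sequence (M : nmodType) (e : nat -> M) :
  conical M -> refinement_monoid M ->
  exists (r : nat -> nat) (alpha : forall n, {additive simplicial (r n) -> M})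
         (phi : forall n, {additive simplicial (r n) -> simplicial (r n.+1)}),
    forall n, [/\ alpha n.+1 \o phi n =1 alpha n, exists x, alpha n.+1 x = e n
      & forall x y, propto (alpha n x) (alpha n y) -> propto (phi n x) (phi n y)].
Proof.
move=> M0 MR.
have next (A : stage M) m : {B : stage M &
    {phi : {additive simplicial (tag A) -> simplicial (tag B)} |
    [/\ tagged B \o phi =1 tagged A, exists x, tagged B x = m
      & forall x y, propto (tagged A x) (tagged A y) -> propto (phi x) (phi y)]}}.
  have [s /cid[beta /cid[phi phiP]]] := cid (extension_step M0 MR (tagged A) m).
  by exists (Tagged (fun r => {additive simplicial r -> M}) beta), phi.
pose A := fix A n : stage M := match n with
  | 0 => Tagged (fun r => {additive simplicial r -> M}) (lin (fun _ : 'I_0 => 0))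
  | n'.+1 => tag (next (A n') (e n')) end.
exists (fun n => tag (A n)), (fun n => tagged (A n)).
by exists (fun n => sval (tagged (next (A n) (e n)))) => n; case: (tagged (next _ _)).
Qed.

Theorem theorem3p9 (M : nmodType) :
  countable [set: M]%classic -> conical M -> refinement_monoid M ->
  exists (Delta : nmodType) (alpha : {additive Delta -> M}),
    [/\ dimension_monoid Delta,
        (forall m : M, exists x : Delta, alpha x = m) &
        (forall x y : Delta, propto (alpha x) (alpha y) -> propto x y)].
Proof.
move=> /countable_enum[e e_surj] M0 MR.
have [r [a [phi /all_and3[aphi a_e phiP]]]] := stage_sequence e M0 MR.
have lim := colim_is_limit phi.
have [alpha [alpha_in _]] := lim.2 M a aphi.
exists (colim phi), alpha; split.
- by exists r, phi; eexists; exact: lim.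
- move=> m; have [n <-] := e_surj m; have [x <-] := a_e n.
  by exists (colim_in phi x); exact: alpha_in.
- move=> d d'; have [n [x [y [-> ->]]]] := colim_in_surj2 d d'.
  have alphaE z : alpha (colim_in phi z) = a n z by exact: alpha_in.
  have phiE z : colim_in phi (phi n z) = colim_in phi z by exact: (colim_inS phi z).
  rewrite !alphaE => /phiP /(propto_additive (colim_in phi (n := n.+1))).
  by rewrite /= !phiE.
Qed.
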